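(* Let $K\subset\mathbb{H}^2$ be a convex body whose boundary $\partial K$ is a $C^1$-smooth curve. If $K$ is origin-symmetric and has constant width $w$, then $K$ is a disc.
   Context: $\mathbb{H}^2$ is the hyperbolic plane, here in the Poincaré disc model with origin $O$ (the center of the model disc). A body is a compact set $K\subset\mathbb{H}^2$ equal to the closure of its non-empty interior. It is convex if its boundary cannot be intersected by a geodesic in more than two points (with the exception that an arc of a geodesic may be part of the boundary). A supporting geodesic of $K$ is a geodesic that has only one common point with $\partial K$, or has a complete arc in common with $\partial K$. A disc is a closed hyperbolic metric ball of positive radius. A convex body $K$ containing $O$ in its interior is origin-symmetric if $-x\in K$ for every $x\in K$ (with $-x$ the Euclidean antipode in the disc model, i.e. the image of $x$ under the hyperbolic point reflection in $O$). Width: for $K$ with $C^1$-smooth boundary and $x\in\partial K$, $n_K(x)$ denotes the geodesic through $x$ perpendicular to the supporting geodesic of $K$ at $x$. Let $\Gamma_2$ be the other supporting geodesic of $K$ (different from the one at $x$) that is orthogonal to $n_K(x)$, and let $\phi(x)$ be the intersection point of $n_K(x)$ and $\Gamma_2$. The width of $K$ at $x$ is $w_K(x)=\big|[x,\phi(x)]\big|$, the hyperbolic length of the geodesic segment $[x,\phi(x)]$. $K$ has constant width $w$ if $w_K(x)=w$ for all $x\in\partial K$. *)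

(* Defs.v *)
From mathcomp Require Import all_boot all_order all_algebra.
From mathcomp Require Import all_classical all_reals all_analysis.

Set Implicit Arguments.
Unset Strict Implicit.
Unset Printing Implicit Defensive.

Import Order.TTheory GRing.Theory Num.Theory.
Import numFieldNormedType.Exports.

Local Open Scope classical_set_scope.
Local Open Scope ring_scope.

(* The hyperbolic plane (curvature -1) is the Poincaré disc model: the open
   Euclidean unit disc in R * R.  It is open in R * R, so compactness, interior
   and closure of a compact subset may be taken in the ambient plane, and its
   C^1 structure is the Euclidean one. *)

Section Hyperbolic.
Variable R : realType.
Implicit Types (p q x c : R * R) (K A : set (R * R)).

Definition dot p q : R := p.1 * q.1 + p.2 * q.2.
Definition normsq p : R := dot p p.

Definition hplane : set (R * R) := [set p | normsq p < 1].

Definition arcosh (t : R) : R := ln (t + Num.sqrt (t ^+ 2 - 1)).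

Definition hdist p q : R :=
  arcosh (1 + 2 * normsq (p - q) / ((1 - normsq p) * (1 - normsq q))).

(* The complete geodesics are the diameters and the arcs of circles orthogonal
   to the unit circle.  Both have an equation a (1 + |p|^2) = 2 <v, p> with
   a^2 < |v|^2: for a = 0 it is a diameter, and for a <> 0 it is the circle with
   centre v / a and squared radius |v / a|^2 - 1.  The pair (a, v) is only
   determined up to a nonzero factor, so geodesics are compared as sets. *)
Record geodesic := Geodesic {
  gcoef : R;
  gvec : R * R;
  gcoef_lt : gcoef ^+ 2 < normsq gvec }.

Definition gset (G : geodesic) : set (R * R) :=
  [set p | hplane p /\ gcoef G * (1 + normsq p) = 2 * dot (gvec G) p].

(* Half the gradient at p of the equation of G: a Euclidean normal vector,
   nonzero at every point of G. *)
Definition gnormal (G : geodesic) p : R * R := gcoef G *: p - gvec G.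

(* The model is conformal, so hyperbolic and Euclidean orthogonality agree. *)
Definition orthogonal_at p (G H : geodesic) : Prop :=
  [/\ gset G p, gset H p & dot (gnormal G p) (gnormal H p) = 0].

Definition boundary K : set (R * R) := closure K `\` interior K.

Definition body K : Prop :=
  [/\ K `<=` hplane, compact K, interior K !=set0 & closure (interior K) = K].

(* For a subset A of a geodesic; a non-degenerate arc. *)
Definition geodesic_arc (G : geodesic) A : Prop :=
  [/\ A `<=` gset G, connected A & exists p q, [/\ A p, A q & p <> q]].

Definition convex_body K : Prop :=
  body K /\
  forall G : geodesic,
    (gset G `&` boundary K #<= `I_2)%card \/
    geodesic_arc G (gset G `&` boundary K).

Definition supporting K (G : geodesic) : Prop :=
  (exists p, gset G `&` boundary K = [set p]) \/
  geodesic_arc G (gset G `&` boundary K).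

(* A regular simple closed curve of class C^1, parametrized with period 1. *)
Definition C1_closed_curve A : Prop :=
  exists g : R -> R * R,
    [/\ forall t, g (t + 1) = g t,
        forall t, derivable g t 1,
        continuous (derive1 g),
        forall t, derive1 g t <> 0 &
        (forall s t, 0 <= s < 1 -> 0 <= t < 1 -> g s = g t -> s = t) /\
        range g = A].

Definition origin_symmetric K : Prop :=
  interior K 0 /\ forall x, K x -> K (- x).

(* [width_at K x w] says that w_K(x) = w: S is the supporting geodesic of K at
   x, N is n_K(x), S' is the other supporting geodesic orthogonal to N, and y is
   phi(x). *)
Definition width_at K x (w : R) : Prop :=
  exists (S N S' : geodesic) (y : R * R),
    [/\ supporting K S /\ orthogonal_at x S N,
        supporting K S' /\ orthogonal_at y S' N,
        gset S' <> gset S &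
        w = hdist x y].

Definition constant_width K (w : R) : Prop :=
  forall x, boundary K x -> width_at K x w.

Definition hyperbolic_disc K : Prop :=
  exists c (r : R),
    [/\ hplane c, 0 < r & K = [set p | hplane p /\ hdist c p <= r]].

End Hyperbolic.

(* Main.v *)
Require Import Defs.
From mathcomp Require Import all_boot all_order all_algebra.
From mathcomp Require Import all_classical all_reals all_analysis.
From mathcomp Require Import ring lra.

Set Implicit Arguments.
Unset Strict Implicit.
Unset Printing Implicit Defensive.

Import Order.TTheory GRing.Theory Num.Theory.
Import numFieldNormedType.Exports.

Local Open Scope classical_set_scope.
Local Open Scope ring_scope.

(** The distance to the origin has a maximum and a minimum on the boundary of
    [K]; both are shown to be half the width, so that the boundary is a circle
    centred at the origin.

    Let [x] be an extremal point.  The boundary curve is smooth, so its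
    tangent at [x] is perpendicular to the ray through [x]; the supporting
    geodesic [S] at [x] is tangent to the curve, hence perpendicular to that ray
    too ([normal_at_critical]).  So the normal geodesic at [x] is the diameter
    through [x].  By symmetry the other supporting geodesic orthogonal to this
    diameter is the image of [S] under the point reflection, and its foot is
    [-x] ([opposite_foot]).  The width at [x] is thus the distance from [x] to
    [-x], which determines the norm of [x].

    What this takes from convexity is that [K] lies on one side of each of
    its supporting geodesics ([supporting_one_side]).  Convexity and support are
    defined by counting boundary points on geodesics, so this is derived from
    connectedness: a geodesic through an interior point leaves [K] in both
    directions, so it is not supporting ([supporting_interior]), and the
    interior points on it form an interval ([interior_geodesically_convex]).
    Both rest on a parametrization of geodesics by intervals, obtained by
    passing to the Klein model. *)

(** * The Euclidean plane *)

Section Plane.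
Variable R : realType.
Implicit Types (p q x v : R * R) (K A : set (R * R)) (G S N : geodesic R).

Lemma scalerE (c x : R) : c *: x = c * x.
Proof. by []. Qed.

Lemma normsq_ge0 p : 0 <= normsq p.
Proof. by rewrite /normsq /dot -!expr2 addr_ge0 ?sqr_ge0. Qed.

Lemma normsq_eq0 p : (normsq p == 0) = (p == 0).
Proof.
case: p => a b.
by rewrite /normsq /dot /= -!expr2 paddr_eq0 ?sqr_ge0// !sqrf_eq0 -pair_eqE.
Qed.

Lemma normsqZ (c : R) p : normsq (c *: p) = c ^+ 2 * normsq p.
Proof. by rewrite /normsq /dot /= !scalerE; ring. Qed.

Lemma normsqN p : normsq (- p) = normsq p.
Proof. by rewrite /normsq /dot /= !mulrNN. Qed.

Lemma dotC p q : dot p q = dot q p.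
Proof. by rewrite /dot; ring. Qed.

Lemma dotZr (c : R) p q : dot p (c *: q) = c * dot p q.
Proof. by rewrite /dot /= !scalerE; ring. Qed.

Lemma dotZl (c : R) p q : dot (c *: p) q = c * dot p q.
Proof. by rewrite dotC dotZr dotC. Qed.

Lemma dotBl p q x : dot (p - q) x = dot p x - dot q x.
Proof. by rewrite /dot /=; ring. Qed.

Lemma dotNr p q : dot p (- q) = - dot p q.
Proof. by rewrite /dot /=; ring. Qed.

Lemma cvg_comp_fst (T : Type) (F : set_system T) (f : T -> R * R) (a : R * R) :
  f @ F --> a -> (f t).1 @[t --> F] --> a.1.
Proof. by move=> fa; apply: cvg_comp fa _; exact: cvg_fst. Qed.

Lemma cvg_comp_snd (T : Type) (F : set_system T) (f : T -> R * R) (a : R * R) :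
  f @ F --> a -> (f t).2 @[t --> F] --> a.2.
Proof. by move=> fa; apply: cvg_comp fa _; exact: cvg_snd. Qed.

Lemma cvg_dot (T : Type) (F : set_system T) (FF : Filter F)
    (f g : T -> R * R) (a b : R * R) :
  f @ F --> a -> g @ F --> b -> dot (f t) (g t) @[t --> F] --> dot a b.
Proof.
move=> fa gb; apply: cvgD; apply: cvgM.
- exact: cvg_comp_fst fa.
- exact: cvg_comp_fst gb.
- exact: cvg_comp_snd fa.
- exact: cvg_comp_snd gb.
Qed.

Lemma continuous_normsq : continuous (@normsq R).
Proof. by move=> p; apply: cvg_dot; exact: cvg_id. Qed.

Definition perp p : R * R := (- p.2, p.1).

Lemma perp_dot_eq0 p q x : x != 0 -> dot p x = 0 -> dot q x = 0 ->
  dot (perp p) q = 0.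
Proof.
case: p q x => p1 p2 [q1 q2] [x1 x2];
  rewrite -pair_eqE /dot /perp /= => x0 px qx.
have e1 : (- p2 * q1 + p1 * q2) * x1 = 0.
  by transitivity (q2 * (p1 * x1 + p2 * x2) - p2 * (q1 * x1 + q2 * x2));
    [ring|rewrite px qx; ring].
have e2 : (- p2 * q1 + p1 * q2) * x2 = 0.
  by transitivity (p1 * (q1 * x1 + q2 * x2) - q1 * (p1 * x1 + p2 * x2));
    [ring|rewrite px qx; ring].
move/eqP: e1; move/eqP: e2; rewrite !mulf_eq0.
by case: eqP => //= _ /eqP x20 /eqP x10; move: x0; rewrite x10 x20 eqxx.
Qed.

Lemma perp_dot_eq0_collinear x v : x != 0 -> dot (perp x) v = 0 ->
  v = (dot x v / normsq x) *: x.
Proof.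
rewrite -normsq_eq0; case: x v => x1 x2 [v1 v2].
rewrite /perp /normsq /dot /= => n0 xv; congr pair; rewrite /= scalerE.
  transitivity (((x1 * v1 + x2 * v2) * x1 - x2 * (- x2 * v1 + x1 * v2)) /
    (x1 * x1 + x2 * x2)); first by field.
  by rewrite xv; field.
transitivity (((x1 * v1 + x2 * v2) * x2 + x1 * (- x2 * v1 + x1 * v2)) /
  (x1 * x1 + x2 * x2)); first by field.
by rewrite xv; field.
Qed.

End Plane.

(** * Geodesics as intervals *)

Section Parametrization.
Variable R : realType.
Implicit Types (p q x v : R * R) (K A : set (R * R)) (G S N : geodesic R).

(** The equation of [G] as a function; its gradient is [2 *: gnormal G p], and
    its sign tells on which side of [G] a point lies. *)
Definition defect G p : R := gcoef G * (1 + normsq p) - 2 * dot (gvec G) p.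

Lemma continuous_defect G : continuous (defect G).
Proof.
move=> p; apply: cvgB.
  apply: cvgM; first exact: cvg_cst.
  by apply: cvgD; [exact: cvg_cst|exact: continuous_normsq].
apply: cvgM; first exact: cvg_cst.
by apply: cvg_dot; [exact: cvg_cst|exact: cvg_id].
Qed.

Lemma gset_defect G p : gset G p <-> hplane p /\ defect G p = 0.
Proof.
rewrite /defect; split=> -[hp e]; split=> //; first by rewrite e subrr.
exact: subr0_eq.
Qed.

(** The map sending [p] to [2 p / (1 + |p|^2)] carries the Poincaré model to the
    Klein model, where [G] becomes the straight chord [<v, k> = a].  [gcoord] is
    the affine coordinate along that chord: a single formula, continuous on the
    whole plane, valid for diameters and circular arcs alike. *)
Definition gcoord G p : R := 2 * dot (perp (gvec G)) p / (1 + normsq p).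

(** [sqrt (1 - |k|^2)], for the point [k] of coordinate [t] on the Klein chord. *)
Definition gheight G (t : R) : R :=
  Num.sqrt (1 - (gcoef G ^+ 2 + t ^+ 2) / normsq (gvec G)).

(** Back from the Klein model, by [k / (1 + sqrt (1 - |k|^2))]. *)
Definition gpoint G (t : R) : R * R :=
  (normsq (gvec G) * (1 + gheight G t))^-1 *:
    (gcoef G *: gvec G + t *: perp (gvec G)).

(** Half the length of the chord in the coordinate [t]: the geodesic is
    parametrized by the open interval from [- gend G] to [gend G]. *)
Definition gend G : R := Num.sqrt (normsq (gvec G) - gcoef G ^+ 2).

Lemma continuous_gcoord G : continuous (gcoord G).
Proof.
move=> p; apply: cvgM.
  apply: cvgM; first exact: cvg_cst.
  by apply: cvg_dot; [exact: cvg_cst|exact: cvg_id].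
apply: cvgV; first by rewrite gt_eqF// ltr_wpDr// normsq_ge0.
by apply: cvgD; [exact: cvg_cst|exact: continuous_normsq].
Qed.

Lemma normsq_gvec_gt0 G : 0 < normsq (gvec G).
Proof. exact: le_lt_trans (sqr_ge0 _) (gcoef_lt G). Qed.

Lemma gheight_ge0 G t : 0 <= gheight G t.
Proof. exact: sqrtr_ge0. Qed.

Lemma continuous_gheight G : continuous (gheight G).
Proof.
move=> t; apply: continuous_comp; last exact: sqrt_continuous.
apply: cvgB; first exact: cvg_cst.
apply: cvgM; last exact: cvg_cst.
by apply: cvgD; [exact: cvg_cst|apply: cvgM; exact: cvg_id].
Qed.

Lemma continuous_gpoint G : continuous (gpoint G).
Proof.
move=> t; apply: cvgZ.
  apply: cvgV.
    by rewrite gt_eqF// mulr_gt0 ?normsq_gvec_gt0// ltr_wpDr// gheight_ge0.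
  apply: cvgM; first exact: cvg_cst.
  by apply: cvgD; [exact: cvg_cst|exact: continuous_gheight].
apply: cvgD; first exact: cvg_cst.
by apply: cvgZ; [exact: cvg_id|exact: cvg_cst].
Qed.

Lemma gheight_sq G t : `|t| <= gend G ->
  t ^+ 2 = normsq (gvec G) * (1 - gheight G t ^+ 2) - gcoef G ^+ 2.
Proof.
have n0 := normsq_gvec_gt0 G; have d0 := gcoef_lt G.
rewrite -(@ler_pXn2r _ 2)// ?nnegrE ?sqrtr_ge0// real_normK ?num_real//.
rewrite sqr_sqrtr ?subr_ge0 ?(ltW d0)// => le_t.
rewrite sqr_sqrtr; first by field; rewrite gt_eqF.
by rewrite subr_ge0 ler_pdivrMr// mul1r; lra.
Qed.

Lemma normsq_gpoint G t : `|t| <= gend G ->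
  normsq (gpoint G t) = (1 - gheight G t) / (1 + gheight G t).
Proof.
move=> /gheight_sq; have := normsq_gvec_gt0 G; have := gheight_ge0 G t.
rewrite /gpoint; case: (gvec G) => v1 v2; move: (gheight G t) (gcoef G) => s a.
rewrite /normsq /dot /perp /= ?scalerE => s0 n0 tE.
transitivity ((a ^+ 2 + t ^+ 2) / ((v1 * v1 + v2 * v2) * (1 + s) ^+ 2)).
  by field; rewrite !gt_eqF//; lra.
by rewrite tE; field; rewrite !gt_eqF//; lra.
Qed.

Lemma dot_gvec_gpoint G t :
  dot (gvec G) (gpoint G t) = gcoef G / (1 + gheight G t).
Proof.
have := normsq_gvec_gt0 G; have := gheight_ge0 G t.
rewrite /gpoint; case: (gvec G) => v1 v2; move: (gheight G t) (gcoef G) => s a.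
rewrite /normsq /dot /perp /= ?scalerE => s0 n0.
by field; rewrite !gt_eqF//; lra.
Qed.

Lemma dot_perp_gpoint G t :
  dot (perp (gvec G)) (gpoint G t) = t / (1 + gheight G t).
Proof.
have := normsq_gvec_gt0 G; have := gheight_ge0 G t.
rewrite /gpoint; case: (gvec G) => v1 v2; move: (gheight G t) (gcoef G) => s a.
rewrite /normsq /dot /perp /= ?scalerE => s0 n0.
by field; rewrite !gt_eqF//; lra.
Qed.

Lemma gpointK G t : `|t| <= gend G -> gcoord G (gpoint G t) = t.
Proof.
move=> lt; rewrite /gcoord dot_perp_gpoint normsq_gpoint//.
have s0 := gheight_ge0 G t.
by field; rewrite !gt_eqF//; lra.
Qed.

Lemma gset_gpoint G t : `|t| < gend G -> gset G (gpoint G t).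
Proof.
move=> ltt; have le := ltW ltt; have := gheight_sq le.
have s0 := gheight_ge0 G t; have n0 := normsq_gvec_gt0 G; move: ltt.
rewrite -(@ltr_pXn2r _ 2)// ?nnegrE ?sqrtr_ge0// real_normK ?num_real//.
rewrite sqr_sqrtr ?subr_ge0 ?(ltW (gcoef_lt G))// => ltt tE.
(* At height 0 the point lies on the ideal boundary. *)
have sp : 0 < gheight G t.
  rewrite lt_neqAle s0 andbT eq_sym; apply/eqP => z; move: tE ltt.
  by rewrite z => ->; rewrite expr0n/= subr0 mulr1 ltxx.
split; rewrite /hplane /= normsq_gpoint//.
  by rewrite ltr_pdivrMr; lra.
by rewrite dot_gvec_gpoint; field; rewrite gt_eqF//; lra.
Qed.

(** The parametrization extends continuously to the ideal end points, which are
    outside the plane, hence outside every body; this is what makes a geodesic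
    leave a body in both directions. *)
Lemma gpoint_end G t : `|t| = gend G -> ~ hplane (gpoint G t).
Proof.
move=> tE; rewrite /hplane /= normsq_gpoint ?tE//.
have -> : gheight G t = 0.
  rewrite /gheight -(real_normK (num_real t)) tE sqr_sqrtr.
    by rewrite subrKC divff ?subrr ?sqrtr0// gt_eqF// normsq_gvec_gt0.
  by rewrite subr_ge0 ltW// gcoef_lt.
by rewrite subr0 addr0 divr1 ltxx.
Qed.

Lemma gcoord_sq G p : gset G p ->
  gcoord G p ^+ 2 =
    normsq (gvec G) * (1 - ((1 - normsq p) / (1 + normsq p)) ^+ 2) - gcoef G ^+ 2.
Proof.
move=> [_ ]; have := normsq_ge0 p; rewrite /gcoord.
case: p (gvec G) => p1 p2 [v1 v2];
  rewrite /normsq /dot /perp /= ?scalerE => p0 e.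
have -> : gcoef G = 2 * (v1 * p1 + v2 * p2) / (1 + (p1 * p1 + p2 * p2)).
  by rewrite -e mulfK// gt_eqF//; lra.
by field; rewrite gt_eqF//; lra.
Qed.

Lemma gcoord_lt G p : gset G p -> `|gcoord G p| < gend G.
Proof.
move=> Gp; rewrite -(@ltr_pXn2r _ 2)// ?nnegrE ?sqrtr_ge0//.
rewrite real_normK ?num_real//.
rewrite sqr_sqrtr ?subr_ge0 ?(ltW (gcoef_lt G))// gcoord_sq// ltrD2r.
rewrite gtr_pMr ?normsq_gvec_gt0// ltrBlDr ltrDl exprn_gt0// divr_gt0//.
  by case: Gp => + _; rewrite /hplane /= subr_gt0.
by rewrite ltr_wpDr// normsq_ge0.
Qed.

Lemma gcoordK G p : gset G p -> gpoint G (gcoord G p) = p.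
Proof.
move=> Gp.
have p0 := normsq_ge0 p; have n0 := normsq_gvec_gt0 G.
have sE : gheight G (gcoord G p) = (1 - normsq p) / (1 + normsq p).
  rewrite /gheight gcoord_sq// subrKC mulrAC divff ?gt_eqF// mul1r subKr.
  rewrite sqrtr_sqr ger0_norm// divr_ge0//; last exact: addr_ge0.
  by case: Gp => + _; rewrite /hplane /= subr_ge0 => /ltW.
rewrite /gpoint sE /gcoord.
case: Gp => _; move: p0 n0 {sE}.
case: p (gvec G) => p1 p2 [v1 v2];
  rewrite /normsq /dot /perp /= ?scalerE => p0 n0 e.
have -> : gcoef G = 2 * (v1 * p1 + v2 * p2) / (1 + (p1 * p1 + p2 * p2)).
  by rewrite -e mulfK// gt_eqF//; lra.
by congr pair; rewrite /= !scalerE; field; rewrite !gt_eqF//; nra.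
Qed.

End Parametrization.

(** * Geodesics and the boundary of a convex body *)

Section Convexity.
Variable R : realType.
Implicit Types (p q x v : R * R) (K A : set (R * R)) (G S N : geodesic R).

(** The interior of [K] is open, and off the boundary it is also the trace of
    [closure K]; so it is clopen in [A]. *)
Lemma connected_sub_interior K A : connected A -> A `&` boundary K = set0 ->
  A `&` K° !=set0 -> A `<=` K°.
Proof.
move=> cA AK0 AK; have E : A `&` K° = A.
  apply: cA => //; first by exists K°; [exact: open_interior|].
  exists (closure K); first exact: closed_closure.
  apply/seteqP; split=> [p [Ap /interior_subset Kp]|p [Ap cKp]].
    by split=> //; exact: subset_closure.
  split=> //; apply: contrapT => nKp.
  by suff : (A `&` boundary K) p by rewrite AK0.
by rewrite -E => p [].
Qed.

Lemma path_hits_boundary K (c : R -> R * R) (s t : R) : s <= t ->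
  continuous c -> K° (c s) -> ~ K (c t) ->
  exists2 u, s < u <= t & boundary K (c u).
Proof.
move=> st cc Ks nKt; apply: contrapT => no.
apply: nKt; apply: interior_subset.
apply: (@connected_sub_interior K (c @` `[s, t])).
- apply: connected_continuous_connected; first exact: segment_connected.
  exact: continuous_subspaceT.
- apply/seteqP; split=> // p [[u /= + <-] bu]; rewrite in_itv/= => /andP[su ut].
  apply: no; exists u => //; rewrite ut andbT lt_neqAle su andbT.
  by apply/eqP => E; move: bu; rewrite -E => -[].
- by exists (c s); split=> //; exists s => //=; rewrite in_itv/= lexx.
- by exists t => //=; rewrite in_itv/= lexx andbT.
Qed.

Lemma body_closed K : body K -> closed K.
Proof.
by case=> _ cK _ _; apply: compact_closed => //; exact: norm_hausdorff.
Qed.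

Lemma body_boundary K : body K -> boundary K = K `\` K°.
Proof. by move=> /body_closed/closure_id; rewrite /boundary => <-. Qed.

Lemma geodesic_exits K G p : body K -> K° p -> gset G p ->
  exists p1 p2, [/\ gcoord G p1 < gcoord G p < gcoord G p2,
    (gset G `&` boundary K) p1 & (gset G `&` boundary K) p2].
Proof.
move=> bK Kp Gp; have [Khp _ _ _] := bK.
have := gcoord_lt Gp; rewrite ltr_norml => /andP[lo up].
have e0 : 0 <= gend G by exact: sqrtr_ge0.
have hb u : boundary K (gpoint G u) -> `|u| <= gend G ->
    (gset G `&` boundary K) (gpoint G u).
  move=> bu ule; split=> //; apply: gset_gpoint; rewrite lt_neqAle ule andbT.
  apply/eqP => ue; apply: (gpoint_end ue); apply: Khp.
  by move: bu; rewrite body_boundary// => -[].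
have [t2 /andP[lt2 t2e] bt2] : exists2 u, gcoord G p < u <= gend G &
    boundary K (gpoint G u).
  apply: path_hits_boundary; first exact: ltW.
  - exact: continuous_gpoint.
  - by rewrite gcoordK.
  by move=> /Khp; apply: gpoint_end; rewrite ger0_norm.
have [t1 /andP[lt1 t1e] bt1] : exists2 u, - gcoord G p < u <= gend G &
    boundary K (gpoint G (- u)).
  apply: (@path_hits_boundary K (fun u => gpoint G (- u))).
  - by rewrite lerNl ltW.
  - move=> u; apply: continuous_comp; first exact: opp_continuous.
    exact: continuous_gpoint.
  - by rewrite opprK gcoordK.
  - by move=> /Khp; apply: gpoint_end; rewrite normrN ger0_norm.
have t2G : `|t2| <= gend G by rewrite ler_norml t2e andbT; lra.
have t1G : `|- t1| <= gend G by rewrite normrN ler_norml t1e andbT; lra.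
exists (gpoint G (- t1)), (gpoint G t2); split; [|exact: hb|exact: hb].
by rewrite !gpointK// lt2 ltrNl lt1.
Qed.

(** [gcoord G] is injective on [G], so it identifies connected subsets of [G]
    with intervals. *)
Lemma geodesic_arc_between G A p q r : geodesic_arc G A -> A p -> A q ->
  gset G r -> gcoord G p <= gcoord G r <= gcoord G q -> A r.
Proof.
move=> [AG cA _] Ap Aq Gr prq.
have /connected_intervalP iA : connected (gcoord G @` A).
  apply: connected_continuous_connected => //.
  by apply: continuous_subspaceT; exact: continuous_gcoord.
have [a Aa aE] : (gcoord G @` A) (gcoord G r).
  by apply: iA prq; [exists p|exists q].
by rewrite -(gcoordK Gr) -aE gcoordK//; exact: AG.
Qed.

(** From an interior point the geodesic would meet the boundary on both sides.
    That excludes a single common point; and a common arc would contain the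
    interior point between those two. *)
Lemma supporting_interior K S p :
  body K -> supporting K S -> gset S p -> ~ K° p.
Proof.
move=> bK sS Sp Kp.
have [p1 [p2 [/andP[lt1 lt2] B1 B2]]] := geodesic_exits bK Kp Sp.
case: sS => [[z E]|arc].
  have e : p1 = p2 by move: B1 B2; rewrite E => -> ->.
  by move: lt1 lt2; rewrite e; lra.
suff [_ [_]] : (gset S `&` boundary K) p by apply.
by apply: (geodesic_arc_between arc B1 B2) => //; rewrite !ltW.
Qed.

Lemma card_le2_eq (T : Type) (A : set T) (x y z : T) : (A #<= `I_2)%card ->
  A x -> A y -> A z -> [\/ x = y, y = z | x = z].
Proof.
move=> /pcard_leP[f] Ax Ay Az.
have fI (a b : T) : A a -> A b -> f a = f b -> a = b.
  by move=> Aa Ab; apply: inj => //; rewrite inE.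
have lt2 (a : T) : A a -> (f a < 2)%N by move=> Aa; exact: (@funS _ _ _ _ f).
have := fI x y Ax Ay; have := fI y z Ay Az; have := fI x z Ax Az.
case: (f x) (lt2 _ Ax) => [|[|//]] _; case: (f y) (lt2 _ Ay) => [|[|//]] _;
  case: (f z) (lt2 _ Az) => [|[|//]] _ xz yz xy.
all: by [apply: Or31; exact: xy|apply: Or32; exact: yz|apply: Or33; exact: xz].
Qed.

(** The definition of convexity counts boundary points only; this is the passage
    to the usual notion.  Beyond [p] and beyond [q] the geodesic meets the
    boundary.  A boundary point between them would be a third one, so the common
    part would be an arc, and that arc would contain the interior point [p]. *)
Lemma interior_geodesically_convex K G p q r : convex_body K ->
  K° p -> K° q -> gset G p -> gset G q -> gset G r ->
  gcoord G p <= gcoord G r <= gcoord G q -> K° r.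
Proof.
move=> [bK cK] Kp Kq Gp Gq Gr /andP[pr rq].
have [p1 [_ [/andP[p1p _] B1 _]]] := geodesic_exits bK Kp Gp.
have [_ [q2 [/andP[_ qq2] _ B2]]] := geodesic_exits bK Kq Gq.
have pq := le_trans pr rq.
have nob z : gset G z -> gcoord G p <= gcoord G z <= gcoord G q ->
    ~ boundary K z.
  move=> Gz /andP[pz zq] bz; case: (cK G) => [le2|arc].
    case: (card_le2_eq le2 B1 (conj Gz bz) B2) => e.
    - by move: p1p; rewrite e; lra.
    - by move: qq2; rewrite -e; lra.
    - by move: p1p; rewrite e; lra.
  suff [_ [_]] : (gset G `&` boundary K) p by apply.
  by apply: (geodesic_arc_between arc B1 B2) => //; lra.
have inG u : gcoord G p <= u <= gcoord G q -> `|u| < gend G.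
  move=> /andP[pu uq]; rewrite ltr_norml.
  have := gcoord_lt Gp; have := gcoord_lt Gq.
  by rewrite !ltr_norml => /andP[_ ?] /andP[? _]; lra.
apply: (@connected_sub_interior K (gpoint G @` `[gcoord G p, gcoord G q])).
- apply: connected_continuous_connected; first exact: segment_connected.
  by apply: continuous_subspaceT; exact: continuous_gpoint.
- apply/seteqP; split=> // _ [[u /= + <-]]; rewrite in_itv/= => ub.
  by apply: nob; [apply/gset_gpoint/inG|rewrite gpointK// ltW// inG].
- exists p; split=> //; exists (gcoord G p); last exact: gcoordK.
  by rewrite /= in_itv/= lexx.
- by exists (gcoord G r); [rewrite /= in_itv/= pr|exact: gcoordK].
Qed.

End Convexity.

(** * Supporting geodesics bound half-planes containing the body *)

Section HalfPlane.
Variable R : realType.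
Implicit Types (p q x v : R * R) (K A : set (R * R)) (G S N : geodesic R).

Lemma diameter_subproof q : q != 0 ->
  (0 : R) ^+ 2 < normsq (q.2, - q.1).
Proof.
move=> q0; have -> : normsq (q.2, - q.1) = normsq q.
  by rewrite /normsq /dot /=; ring.
by rewrite expr0n lt_neqAle normsq_ge0 andbT eq_sym normsq_eq0.
Qed.

(** The normal vector is chosen so that [gcoord] increases from the origin
    towards [q]. *)
Definition diameter q (q0 : q != 0) : geodesic R :=
  Geodesic (diameter_subproof q0).

(** [gcoef S * defect S] is positive at the origin.  If it were negative
    somewhere on [K], it would be so at some interior point [q], and the
    diameter through [q] would meet [S] between [0] and [q], in the interior of
    [K]. *)
Lemma supporting_one_side K S : convex_body K -> K° 0 -> supporting K S ->
  gcoef S != 0 /\ forall p, K p -> 0 <= gcoef S * defect S p.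
Proof.
move=> cK K0 sS; have [bK _] := cK; have [Khp _ _ clK] := bK.
have h0 : hplane (0 : R * R) by apply: Khp; exact: interior_subset.
have d0 : defect S 0 = gcoef S.
  by rewrite /defect /normsq /dot /=; ring.
have a0 : gcoef S != 0.
  apply/eqP => a0; apply: (supporting_interior bK sS _ K0).
  by apply/gset_defect; rewrite d0.
split=> // p Kp; rewrite leNgt; apply/negP => neg.
have cf : continuous (fun z => gcoef S * defect S z).
  by move=> z; apply: cvgM; [exact: cvg_cst|exact: continuous_defect].
have [q [Kq qneg]] : (K° `&` [set z | (gcoef S * defect S z < 0)%R]) !=set0.
  move: Kp; rewrite -{1}clK; apply; apply: open_nbhs_nbhs; split=> //.
  apply: (@open_comp _ _ _ [set r : R | r < 0]) => [z _|]; first exact: cf.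
  exact: open_lt.
have q0 : q != 0.
  apply/eqP => q0; move: qneg; rewrite q0 /= d0 -expr2.
  by rewrite ltNge sqr_ge0.
have hq : hplane q by apply: Khp; exact: interior_subset.
set D := diameter q0.
have D0 : gset D 0 by split=> //; rewrite /normsq /dot /=; ring.
have Dq : gset D q by split=> //; rewrite /normsq /dot /=; ring.
have c0 : gcoord D 0 = 0.
  by rewrite /gcoord (_ : dot _ 0 = 0) ?mulr0 ?mul0r// /dot /=; ring.
have cq : 0 <= gcoord D q.
  rewrite /gcoord; have -> : dot (perp (gvec D)) q = normsq q.
    by rewrite /normsq /perp /dot /=; ring.
  by have q_ge0 := normsq_ge0 q; rewrite divr_ge0 //; lra.
(* The sign changes along the diameter, so [S] is crossed at a parameter [u]. *)
have [||u + fu] := @IVT R (fun t => gcoef S * defect S (gpoint D t))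
    0 (gcoord D q) 0 cq.
- apply: continuous_subspaceT => t.
  exact: continuous_comp (@continuous_gpoint _ D t) (cf _).
- have p0 : gpoint D 0 = 0 by rewrite -c0 gcoordK.
  by rewrite p0 gcoordK// d0 -expr2 ge_min le_max sqr_ge0 (ltW qneg) orbT.
rewrite in_itv/= => /andP[u0 uq].
have ule : `|u| < gend D.
  rewrite ger0_norm// (le_lt_trans uq)//.
  exact: le_lt_trans (ler_norm _) (gcoord_lt Dq).
have Du := gset_gpoint ule.
have Su : gset S (gpoint D u).
  apply/gset_defect; split; first by case: Du.
  by move/eqP: fu; rewrite mulf_eq0 (negbTE a0) => /eqP.
apply: (supporting_interior bK sS Su).
apply: (interior_geodesically_convex cK K0 Kq D0 Dq Du).
by rewrite c0 gpointK ?u0 ?uq// ltW.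
Qed.

End HalfPlane.

(** * Extremal points of the distance to the origin *)

Section Extremal.
Variable R : realType.
Implicit Types (p q x v : R * R) (K A : set (R * R)) (G S N : geodesic R).

Lemma is_derive_fst_snd (g : R -> R * R) t : derivable g t 1 ->
  is_derive t 1 (fun s => (g s).1) (derive1 g t).1 /\
  is_derive t 1 (fun s => (g s).2) (derive1 g t).2.
Proof.
move=> /[dup] dg; rewrite derive1E; set l := 'D_1 g t => gl.
have {gl}gl : h^-1 *: (g (h *: 1 + t) - g t) @[h --> 0^'] --> l := gl.
have g1 := cvg_comp_fst gl; have g2 := cvg_comp_snd gl.
by split; apply: DeriveDef; [exact: cvgP g1|exact: cvg_lim g1
                            |exact: cvgP g2|exact: cvg_lim g2].
Qed.

(** Both [normsq] and [defect G] are, up to constants, functions of this form;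
    so this one computation serves for the distance to the origin and for the
    position relative to a supporting geodesic. *)
Lemma quadratic_critical (g : R -> R * R) t (a : R) v :
  (forall s, derivable g s 1) ->
  (forall s, a * normsq (g t) - 2 * dot v (g t) <=
             a * normsq (g s) - 2 * dot v (g s)) ->
  dot (a *: g t - v) (derive1 g t) = 0.
Proof.
move=> dg tmin.
pose f s : R := a * ((g s).1 * (g s).1 + (g s).2 * (g s).2)
  - 2 * (v.1 * (g s).1 + v.2 * (g s).2).
have df (s : R) : is_derive s (1 : R) f (2 * dot (a *: g s - v) (derive1 g s)).
  have [d1 d2] := is_derive_fst_snd (dg s).
  apply: is_derive_eq.
  by rewrite /dot /= !scalerE; ring.
have : is_derive t (1 : R) f 0.
  apply: (@derive1_at_min R f (t - 1) (t + 1)).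
  - lra.
  - by move=> s _; exact: ex_derive.
  - by rewrite in_itv/=; lra.
  - by move=> s _; exact: tmin.
move=> f0; have := @derive_val _ _ _ _ _ _ _ (df t).
by rewrite (@derive_val _ _ _ _ _ _ _ f0); lra.
Qed.

(** Where the boundary curve is extremal for the distance to the origin, its
    velocity is orthogonal to the position vector.  The curve also stays on one
    side of [S], so the velocity is orthogonal to the normal of [S] as well.  In
    the plane the two vectors are therefore collinear.  The sign of [e] selects
    between a minimum and a maximum. *)
Lemma normal_at_critical K S (g : R -> R * R) t (e : R) :
  convex_body K -> K° 0 ->
  (forall s, derivable g s 1) -> derive1 g t <> 0 -> range g = boundary K ->
  supporting K S -> gset S (g t) ->
  e != 0 -> (forall s, e * normsq (g t) <= e * normsq (g s)) ->
  dot (perp (g t)) (gnormal S (g t)) = 0.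
Proof.
move=> cK K0 dg g'0 gK sS Sgt e0 emin.
have [bK _] := cK; have [a0 side] := supporting_one_side cK K0 sS.
apply: (perp_dot_eq0 (x := derive1 g t)); first exact/eqP.
  have : dot (e *: g t - 0) (derive1 g t) = 0.
    apply: quadratic_critical => // s.
    by have := emin s; rewrite /dot /=; lra.
  by rewrite subr0 dotZl => /eqP; rewrite mulf_eq0 (negbTE e0) => /eqP.
have : dot (gcoef S ^+ 2 *: g t - gcoef S *: gvec S) (derive1 g t) = 0.
  apply: quadratic_critical => // s.
  have : K (g s).
    suff : boundary K (g s) by rewrite body_boundary// => -[].
    by rewrite -gK; exists s.
  move=> /side; have /gset_defect[_] := Sgt; rewrite /defect.
  rewrite !dotZl; nra.
rewrite expr2 -scalerA -scalerBr dotZl => /eqP.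
by rewrite mulf_eq0 (negbTE a0) => /eqP.
Qed.

End Extremal.

(** * The opposite supporting geodesic *)

Section Opposite.
Variable R : realType.
Implicit Types (p q x v : R * R) (K A : set (R * R)) (G S N : geodesic R).

Lemma radial_geodesic G x : x != 0 -> dot (perp x) (gvec G) = 0 ->
  exists c k, [/\ c != 0, gcoef G = c * k & gvec G = c *: x].
Proof.
move=> x0 xv; have := perp_dot_eq0_collinear x0 xv.
set c := (dot _ _ / _) => vE.
have c0 : c != 0.
  apply/eqP => c0; have := normsq_gvec_gt0 G.
  by rewrite vE c0 scale0r (_ : normsq 0 = 0) ?ltxx// /normsq /dot /=; ring.
by exists c, (gcoef G / c); split=> //; rewrite mulrCA divff ?mulr1.
Qed.

(** The geodesics perpendicular to the diameter through [x] form a family with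
    the single parameter [k], the level of [2 <x, p> / (1 + |p|^2)]. *)
Lemma gset_radial G x (c k : R) :
  c != 0 -> gcoef G = c * k -> gvec G = c *: x ->
  gset G = [set p | hplane p /\ k * (1 + normsq p) = 2 * dot x p].
Proof.
move=> c0 aE vE; apply/seteqP; rewrite /gset aE vE.
split=> p [hp e]; split=> //.
  apply: (mulfI c0); rewrite mulrA e dotZl; ring.
by rewrite -mulrA e dotZl; ring.
Qed.

Lemma supporting_meets K S : supporting K S -> gset S `&` boundary K !=set0.
Proof. by case=> [[p ->]|[_ _ [p [q [Sp _ _]]]]]; exists p. Qed.

(** As [S] is perpendicular to the ray through [x], the geodesic [N] is the
    diameter through [x], and [S] and [S'] are the levels [k > 0] and [l] of
    [2 <x, p> / (1 + |p|^2)].  On [K], which is symmetric and on one side of [S],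
    that function stays between [-k] and [k]; as [S'] meets [K], so does [l]. On
    the other hand [x] and [-x], at the levels [k] and [-k], are both on the
    side of [S'] that contains the origin, which forces [|l| >= k].  Since
    [S' <> S], only [l = -k] is left: [S'] is the reflected image of [S]. *)
Lemma opposite_foot K S N S' x y : convex_body K -> origin_symmetric K ->
  K x -> supporting K S -> orthogonal_at x S N ->
  dot (perp x) (gnormal S x) = 0 ->
  supporting K S' -> orthogonal_at y S' N -> gset S' <> gset S ->
  y = - x.
Proof.
move=> cK [K0 symK] Kx sS [Sx Nx SN] rad sS' [S'y Ny S'N] SS'.
have [bK _] := cK.
have [a0 sideS] := supporting_one_side cK K0 sS.
have [a'0 sideS'] := supporting_one_side cK K0 sS'.
have x0 : x != 0.
  apply/eqP => x0; case: Sx; rewrite x0 /normsq /dot /= => _ /eqP.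
  by rewrite !mulr0 !addr0 mulr0 mulr1 (negbTE a0).
have r0 : 0 < normsq x by rewrite lt_neqAle normsq_ge0 andbT eq_sym normsq_eq0.
have r1 : normsq x < 1 by case: Sx.
have [d [k [d0 aE vE]]] : exists c k,
    [/\ c != 0, gcoef S = c * k & gvec S = c *: x].
  apply: radial_geodesic => //; apply/eqP; rewrite -oppr_eq0 -rad; apply/eqP.
  by rewrite /gnormal /dot /perp /= !scalerE; ring.
have SE := gset_radial d0 aE vE.
have kE : k * (1 + normsq x) = 2 * normsq x by move: Sx; rewrite SE => -[].
have k0 : k != 0 by move: a0; rewrite aE mulf_eq0 negb_or => /andP[].
have k1 : k - 1 != 0.
  by apply/eqP => /subr0_eq k1; move: kE; rewrite k1; lra.
have xN : dot x (gnormal N x) = 0.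
  have : (d * (k - 1)) * dot x (gnormal N x) = 0.
    by rewrite -SN /gnormal aE vE /dot /= !scalerE; ring.
  by move/eqP; rewrite !mulf_eq0 (negbTE d0) (negbTE k1) => /eqP.
(* [N] passes through the origin. *)
have [b0 xu] : gcoef N = 0 /\ dot x (gvec N) = 0.
  have [_ Nx'] := Nx.
  have e : dot x (gnormal N x) = gcoef N * normsq x - dot x (gvec N).
    by rewrite /gnormal /normsq /dot /= !scalerE; ring.
  have : gcoef N * (1 - normsq x) = 0 by move: Nx'; rewrite dotC; lra.
  move=> /eqP; rewrite mulf_eq0 subr_eq0 (gt_eqF r1) orbF => /eqP b0.
  by split=> //; move: e; rewrite b0; lra.
have u0 : gvec N != 0.
  apply/eqP => u0; have := normsq_gvec_gt0 N.
  by rewrite u0 /normsq /dot /= mulr0 addr0 ltxx.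
have uy : dot y (gvec N) = 0.
  by have [_] := Ny; rewrite b0 mul0r dotC; lra.
have uv' : dot (gvec S') (gvec N) = 0.
  move: S'N; rewrite /gnormal b0 scale0r sub0r dotNr => /eqP; rewrite oppr_eq0.
  by rewrite dotBl dotZl uy mulr0 sub0r oppr_eq0 => /eqP.
have [c [l [c0 a'E v'E]]] := radial_geodesic x0 (perp_dot_eq0 u0 xu uv').
have S'E := gset_radial c0 a'E v'E.
have l0 : l != 0 by move: a'0; rewrite a'E mulf_eq0 negb_or => /andP[].
(* The one-sided inequality, in terms of the level. *)
have sideE G (m j : R) p : m != 0 -> gcoef G = m * j -> gvec G = m *: x ->
    0 <= gcoef G * defect G p -> 0 <= j * (j * (1 + normsq p) - 2 * dot x p).
  move=> m0 jE wE.
  have -> : gcoef G * defect G p =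
      m ^+ 2 * (j * (j * (1 + normsq p) - 2 * dot x p)).
    by rewrite /defect jE wE dotZl; ring.
  by rewrite pmulr_rge0// exprn_even_gt0.
have dotxN p : dot x (- p) = - dot x p := dotNr x p.
have [z [S'z bz]] := supporting_meets sS'.
have Kz : K z by move: bz; rewrite body_boundary// => -[].
have := sideE _ _ _ _ c0 a'E v'E (sideS' _ Kx).
have := sideE _ _ _ _ c0 a'E v'E (sideS' _ (symK _ Kx)).
have := sideE _ _ _ _ d0 aE vE (sideS _ Kz).
have := sideE _ _ _ _ d0 aE vE (sideS _ (symK _ Kz)).
rewrite !dotxN !normsqN -/(normsq x) => z1 z2 x1 x2.
have zE : l * (1 + normsq z) = 2 * dot x z by move: S'z; rewrite S'E => -[].
have kp : 0 < k.
  by rewrite -(@pmulr_lgt0 _ (1 + normsq x)) ?kE//; lra.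
have zp : 0 < 1 + normsq z by have := normsq_ge0 z; lra.
have lk1 : l <= k.
  move: z2; rewrite -zE -mulrBl pmulr_rge0// pmulr_lge0//; lra.
have lk2 : - k <= l.
  move: z1; rewrite mulrN opprK -zE -mulrDl pmulr_rge0// pmulr_lge0//; lra.
have xp : 0 < 1 + normsq x by lra.
have l1 : 0 <= l * (l - k).
  by move: x2; rewrite -/(normsq x) -kE -mulrBl mulrA pmulr_lge0.
have l2 : 0 <= l * (l + k).
  by move: x1; rewrite mulrN opprK -/(normsq x) -kE -mulrDl mulrA pmulr_lge0.
have lE : l = - k.
  have lk : l <> k by move=> lk; apply: SS'; rewrite SE S'E lk.
  move/eqP: l0 => l0; nra.
have xy : dot (perp x) y = 0 by apply: (perp_dot_eq0 u0) => //.
have hy : normsq y < 1 by case: S'y.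
have yE : l * (1 + normsq y) = 2 * dot x y by move: S'y; rewrite S'E => -[].
have [s ys] : exists s, y = s *: x.
  by exists (dot x y / normsq x); exact: perp_dot_eq0_collinear.
rewrite ys normsqZ in hy.
move: yE; rewrite lE ys normsqZ dotZr -/(normsq x) => yE.
(* The line through [x] meets the circle carrying [S'] in [-x] and in the point
   inverse to it in the unit circle, which is outside the plane. *)
have : (normsq x * (1 + s * normsq x)) * (1 + s) = 0.
  have : k * (1 + normsq x) * (1 + s ^+ 2 * normsq x) +
      2 * (s * normsq x) * (1 + normsq x) = 0 by rewrite -yE; ring.
  by rewrite kE; lra.
move/eqP; rewrite mulf_eq0 => /orP[|/eqP s1].
  rewrite mulf_eq0 gt_eqF//= => /eqP sx; exfalso.
  have sx' : s * normsq x = -1 by lra.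
  have : (s * normsq x) ^+ 2 < 1.
    by rewrite exprMn expr2 mulrA; nra.
  by rewrite sx' sqrrN expr1n ltxx.
have -> : s = -1 by lra.
by rewrite scaleN1r.
Qed.

End Opposite.

(** * Hyperbolic distances from the origin and between antipodes *)

Section Distances.
Variable R : realType.
Implicit Types (p q x v : R * R) (K A : set (R * R)) (G S N : geodesic R).

Lemma arcosh_lt (s t : R) : 1 <= s -> s < t -> arcosh s < arcosh t.
Proof.
move=> s1 st; have s0 : 0 < s by lra.
have t0 : 0 < t by lra.
have pos (u : R) : 0 < u -> u + Num.sqrt (u ^+ 2 - 1) \in Num.pos.
  by move=> u0; rewrite posrE ltr_wpDr// sqrtr_ge0.
rewrite /arcosh ltr_ln ?pos//.
by rewrite ltr_leD// ler_wsqrtr// lerB// ler_pXn2r ?nnegrE ?ltW.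
Qed.

Lemma arcosh_mono (s t : R) : 1 <= s -> 1 <= t ->
  (arcosh s <= arcosh t) = (s <= t).
Proof.
move=> s1 t1; case: (ltgtP s t) => [st|ts|->]; last exact: lexx.
  by rewrite ltW// arcosh_lt.
by rewrite leNgt arcosh_lt.
Qed.

Lemma arcosh_inj (s t : R) : 1 <= s -> 1 <= t -> arcosh s = arcosh t -> s = t.
Proof.
move=> s1 t1 st; apply: le_anti; apply/andP.
by split; rewrite -arcosh_mono// st.
Qed.

Lemma hdist0 p : hdist 0 p = arcosh (1 + 2 * normsq p / (1 - normsq p)).
Proof.
rewrite /hdist sub0r normsqN (_ : normsq 0 = 0) ?subr0 ?mul1r//.
by rewrite /normsq /dot /=; ring.
Qed.

Lemma hdist0_le p q : hplane p -> hplane q ->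
  (hdist 0 p <= hdist 0 q) = (normsq p <= normsq q).
Proof.
rewrite /hplane /= => hp hq; have p0 := normsq_ge0 p; have q0 := normsq_ge0 q.
have ge1 (r : R) : 0 <= r -> r < 1 -> 1 <= 1 + 2 * r / (1 - r).
  by move=> r0 r1; rewrite lerDl divr_ge0 ?mulr_ge0// subr_ge0 ltW.
rewrite !hdist0 arcosh_mono ?ge1// lerD2l.
rewrite ler_pdivrMr ?subr_gt0// mulrAC ler_pdivlMr ?subr_gt0//.
by apply/idP/idP; lra.
Qed.

Lemma hdist_opp_inj p q : hplane p -> hplane q ->
  hdist p (- p) = hdist q (- q) -> normsq p = normsq q.
Proof.
rewrite /hplane /= => hp hq; have p0 := normsq_ge0 p; have q0 := normsq_ge0 q.
have dE x : hdist x (- x) =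
    arcosh (1 + 8 * normsq x / ((1 - normsq x) ^+ 2)).
  rewrite /hdist normsqN expr2 (_ : normsq (x - - x) = 4 * normsq x); last first.
    by rewrite /normsq /dot /=; ring.
  by rewrite mulrA -natrM.
have ge1 (r : R) : 0 <= r -> 1 <= 1 + 8 * r / (1 - r) ^+ 2.
  by move=> r0; rewrite lerDl divr_ge0 ?sqr_ge0//; lra.
rewrite !dE => /(arcosh_inj (ge1 _ p0) (ge1 _ q0))/addrI.
move/eqP; rewrite eqr_div; try by rewrite expf_neq0// subr_eq0 gt_eqF.
move=> /eqP f.
have : (normsq p - normsq q) * (1 - normsq p * normsq q) = 0.
  transitivity ((8 * normsq p * (1 - normsq q) ^+ 2 -
    8 * normsq q * (1 - normsq p) ^+ 2) / 8); first by field.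
  by rewrite f subrr mul0r.
move/eqP; rewrite mulf_eq0 => /orP[/eqP|/eqP]; first by lra.
by nra.
Qed.

End Distances.

(** * From the two extremal points to a disc *)

Section Disc.
Variable R : realType.
Implicit Types (p q x v : R * R) (K A : set (R * R)) (G S N : geodesic R).

Lemma continuous_ray p : continuous (fun u : R => u *: p).
Proof. by move=> u; apply: cvgZ; [exact: cvg_id|exact: cvg_cst]. Qed.

(** Otherwise the boundary would have a point off the circle: on the ray beyond
    a point of [K] outside the circle, or between the origin and a point of the
    disc that is not in [K]. *)
Lemma body_boundary_normsq K (r : R) : body K -> K° 0 -> 0 <= r ->
  (forall p, boundary K p -> normsq p = r) ->
  K = [set p | normsq p <= r].
Proof.
move=> bK K0 r0 bE; have [Khp _ _ _] := bK; have KE := body_boundary bK.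
have bK' p : boundary K p -> K p by rewrite KE => -[].
apply/seteqP; split=> p /= Kp.
  rewrite leNgt; apply/negP => rp.
  have Ip : K° p.
    apply: contrapT => nI; have : boundary K p by rewrite KE.
    by move=> /bE e; move: rp; rewrite e ltxx.
  have p1 : normsq p < 1 := Khp _ Kp.
  have p0 := le_lt_trans r0 rp.
  (* At the parameter [|p|^-2] the ray has left the unit disc. *)
  have p1V : 1 <= (normsq p)^-1 by rewrite invf_ge1// ltW.
  have [||u /andP[u1 _] /bE] := @path_hits_boundary R K (fun u => u *: p)
    1 (normsq p)^-1 p1V (@continuous_ray p).
  - by rewrite scale1r.
  - move=> /Khp; rewrite /hplane /= normsqZ expr2 mulfVK ?gt_eqF//.
    by rewrite ltNge p1V.
  rewrite normsqZ => e; move: rp; rewrite -e ltNge ler_peMl ?normsq_ge0//.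
  by rewrite exprn_ege1// ltW.
apply: contrapT => nKp.
have [||u /andP[u0 u1] bu] := @path_hits_boundary R K (fun u => u *: p)
  0 1 ler01 (@continuous_ray p).
- by rewrite scale0r.
- by rewrite scale1r.
have := bE _ bu; rewrite normsqZ => e.
case: (ltgtP u 1) u1 => // [u1|u1] _; last first.
  by apply: nKp; apply: bK'; move: bu; rewrite u1 scale1r.
have u2 : u ^+ 2 < 1 by rewrite expr_lt1// ltW.
have pp : normsq p = 0.
  by apply/eqP; rewrite eq_le normsq_ge0 andbT leNgt; apply/negP => n0; nra.
move/eqP: pp; rewrite normsq_eq0 => /eqP pp.
by apply: nKp; rewrite pp; exact: interior_subset.
Qed.

Lemma boundary_compact K : body K -> compact (boundary K).
Proof.
move=> bK; have [_ cK _ _] := bK; rewrite (body_boundary bK).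
apply: (subclosed_compact _ cK) => [|p []//].
apply: closedI; first exact: body_closed.
by apply: open_closedC; exact: open_interior.
Qed.

Lemma boundary_neq0 K : body K -> K° 0 -> boundary K !=set0.
Proof.
move=> bK K0; have [Khp _ _ _] := bK.
have [||u _ bu] := @path_hits_boundary R K (fun u => u *: (1, 0)) 0 1 ler01
  (@continuous_ray (1, 0)).
- by rewrite scale0r.
- by move=> /Khp; rewrite scale1r /hplane /normsq /dot /= mulr1 mulr0 addr0 ltxx.
- by exists (u *: (1, 0)).
Qed.

Lemma critical_width K (w e : R) (g : R -> R * R) t : convex_body K ->
  origin_symmetric K -> constant_width K w ->
  (forall s, derivable g s 1) -> (forall s, derive1 g s <> 0) ->
  range g = boundary K -> e != 0 ->
  (forall s, e * normsq (g t) <= e * normsq (g s)) ->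
  w = hdist (g t) (- g t).
Proof.
move=> cK oK wK dg g'0 gK e0 emin; have [bK _] := cK; have [K0 _] := oK.
have bt : boundary K (g t) by rewrite -gK; exists t.
have Kt : K (g t) by move: bt; rewrite body_boundary// => -[].
have [S [N [S' [y [[sS oSN] [sS' oS'N] SS' ->]]]]] := wK _ bt.
have [St _ _] := oSN.
congr hdist; apply: (opposite_foot cK oK Kt sS oSN _ sS' oS'N SS').
exact: normal_at_critical gK sS St e0 emin.
Qed.

End Disc.

Theorem theorem4p1 (R : realType) (K : set (R * R)) (w : R) :
  convex_body K -> C1_closed_curve (boundary K) ->
  origin_symmetric K -> constant_width K w ->
  hyperbolic_disc K.
Proof.
move=> cK [g [_ dg _ g'0 [_ gK]]] oK wK.
have [bK _] := cK; have [K0 _] := oK; have [Khp _ _ _] := bK.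
have bb0 := boundary_neq0 bK K0; have cb := boundary_compact bK.
have cn : {within boundary K, continuous (@normsq R)}.
  by apply: continuous_subspaceT; exact: continuous_normsq.
have [x /set_mem bx xmax] := compact_EVT_max bb0 cb cn.
have [z /set_mem bz zmin] := compact_EVT_min bb0 cb cn.
have bh p : boundary K p -> hplane p.
  by rewrite body_boundary// => -[Kp _]; exact: Khp.
have bg s : g s \in boundary K by rewrite inE -gK; exists s.
have [s _ sx] : range g x by rewrite gK.
have [t _ tz] : range g z by rewrite gK.
have wx : w = hdist x (- x).
  rewrite -sx; apply: (@critical_width _ _ _ (-1)) gK _ _ => // u.
  by rewrite sx !mulN1r lerN2 xmax.
have wz : w = hdist z (- z).
  rewrite -tz; apply: (@critical_width _ _ _ 1) gK _ _ => // u.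
  by rewrite tz !mul1r zmin.
have xz : normsq x = normsq z.
  by apply: hdist_opp_inj; rewrite -?wx -?wz//; exact: bh.
have KE : K = [set p | normsq p <= normsq x].
  apply: body_boundary_normsq; [exact: bK|exact: K0| |move=> p bp].
    exact: normsq_ge0.
  by apply/eqP; rewrite eq_le xmax ?inE//= xz zmin ?inE.
have hx := bh _ bx.
have h0 : hplane (0 : R * R) by apply: Khp; exact: interior_subset.
exists 0, (hdist 0 x); split=> //.
  have x0 : 0 < normsq x.
    rewrite lt_neqAle normsq_ge0 andbT eq_sym normsq_eq0; apply/eqP => x0.
    by move: bx; rewrite body_boundary// x0 => -[].
  have <- : arcosh 1 = 0 :> R by rewrite /arcosh expr1n subrr sqrtr0 addr0 ln1.
  rewrite hdist0 arcosh_lt// ltrDl divr_gt0 ?mulr_gt0// subr_gt0; exact: hx.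
apply/seteqP; split=> p.
  move=> Kp; have hp := Khp _ Kp; split=> //.
  by rewrite hdist0_le//; move: Kp; rewrite {1}KE.
by move=> [hp]; rewrite hdist0_le// KE.
Qed.
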